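(* Let $n\in\mathbb{Z}_+^d$ be a prebasis. If two paths $P$, $P'$ in $\mathbb{Z}^d$ have the same start and end points and $f\in X_n$, then $Pf=P'f$. In particular, if $P$ is a cycle (a path whose start and end points coincide), then $Pf=0$.
   Context: $\mathbb{N}=\{0,1,2,\dots\}$, $\mathbb{Z}_+$ is the set of positive integers, $\Sigma_N=\{0,\dots,N-1\}$. Vectors are ordered coordinatewise; $\mathbf{0},\mathbf{1}$ are constant vectors; $e_i$ are the standard basis vectors. A prebasis of dimension $d$ is any $n\in\mathbb{Z}_+^d$; put $N=\prod_i n[i]$ and $m(n,v)=\prod_{j=1}^d n[j]^{-v[j]}$ for $v\in\mathbb{Z}^d$; the weight of $v$ is $\mathrm{wgt}_n(v)=m(n,v)$. For $a\in\mathbb{N}$ and $\mathbf{0}\ge v_1\ge v_2$ in $\mathbb{Z}^d$, $\mathrm{base}_n(a,(v_1,v_2))[2]$ denotes the integer $a_1$ in the unique representation $a=a_0+a_1m(n,v_1)+a_2m(n,v_2)$ with integers $0\le a_0<m(n,v_1)$, $0\le a_1<m(n,v_2)/m(n,v_1)$, $a_2\ge0$. For $a\in\Sigma_N$, the multiplication cube $\mathrm{cube}_n(a)$ is the function on pairs $v_1\ge v_2$ in $\{-1,0\}^d$ given by $\mathrm{cube}_n(a)[v_1,v_2]=\mathrm{base}_n(a,(v_1,v_2))[2]$; $T_n=\{\mathrm{cube}_n(a):a\in\Sigma_N\}$. $X_n$ is the set of maps $f:\mathbb{Z}^d\to T_n$ such that $f[z][\mathbf{0},-\mathbf{1}+e_i]=f[z+e_i][-e_i,-\mathbf{1}]$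 for all $z\in\mathbb{Z}^d$, $1\le i\le d$. For $f\in X_n$ the undirected edge $\{z-e_i,z\}$ ($z\in\mathbb{Z}^d$) has label $\lambda(f,\{z-e_i,z\})=f[z][\mathbf{0},-e_i]$ (one gets the same value from any cube containing this edge: $\lambda(f,\{z+p-e_i,z+p\})=f[z][p,p-e_i]$ for $p\in\{-1,0\}^d$ with $p[i]=0$). A path is a sequence $P=(P_i)_{i=1}^k$ in $\mathbb{Z}^d$ such that each $P_{i+1}-P_i$ equals $ae_j$ for some $a\in\{-1,1\}$, $1\le j\le d$. If $p'-p=ae_j$ with $a\in\{-1,1\}$, then $(p,p')f=a\,\mathrm{wgt}_n(\max\{p,p'\})\,\lambda(f,\{p,p'\})$. The path integral of $f$ over $P$ is $Pf=\sum_{i=1}^{k-1}(P_i,P_{i+1})f$. *)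

(* Defs.v *)
From HB Require Import structures.
From mathcomp Require Import all_boot all_order all_algebra.
From mathcomp Require Import classical_sets.

Set Implicit Arguments.
Unset Strict Implicit.
Unset Printing Implicit Defensive.

Import Order.TTheory GRing.Theory Num.Theory.
Local Open Scope ring_scope.

Notation vec d := 'rV[int]_d.

Definition cst (d : nat) (c : int) : vec d := const_mx c.

Definition e (d : nat) (i : 'I_d) : vec d := delta_mx 0 i.

(* The coordinatewise order. *)
Definition lev (d : nat) (u v : vec d) : bool := [forall i, u 0 i <= v 0 i].

Definition vmax (d : nat) (u v : vec d) : vec d :=
  \row_i Num.max (u 0 i) (v 0 i).

Definition prebasis (d : nat) (n : 'I_d -> nat) : Prop :=
  forall i, (0 < n i)%N.

Definition pbN (d : nat) (n : 'I_d -> nat) : nat := (\prod_i n i)%N.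

(* Rational-valued, since v is an arbitrary integer vector. *)
Definition m (d : nat) (n : 'I_d -> nat) (v : vec d) : rat :=
  \prod_j (n j)%:Q ^ (- v 0 j).

Definition wgt (d : nat) (n : 'I_d -> nat) (v : vec d) : rat := m n v.

Definition base_repr (d : nat) (n : 'I_d -> nat) (a : nat) (v1 v2 : vec d)
    (a0 a1 a2 : nat) : Prop :=
  [/\ a%:Q = a0%:Q + a1%:Q * m n v1 + a2%:Q * m n v2,
      a0%:Q < m n v1 & a1%:Q < m n v2 / m n v1].

(* base_n(a, (v1, v2))[2]: the middle digit a1 of the representation of a, which
   exists and is unique when 0 >= v1 >= v2; no meaning is attached to the value
   for other v1, v2. *)
Definition base_digit (d : nat) (n : 'I_d -> nat) (a : nat) (v1 v2 : vec d)
    : nat :=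
  xget 0%N (fun a1 => exists a0 a2, base_repr n a v1 v2 a0 a1 a2).

Definition in_cube (d : nat) (v : vec d) : bool :=
  [forall i, (v 0 i == -1) || (v 0 i == 0)].

Definition cube_dom (d : nat) (v1 v2 : vec d) : bool :=
  [&& in_cube v1, in_cube v2 & lev v2 v1].

(* Functions on the pairs v1 >= v2 in {-1,0}^d are encoded as functions on all
   pairs of vectors that vanish outside this domain, so that Leibniz equality of
   two cubes is equality on the domain. *)
Definition cube (d : nat) (n : 'I_d -> nat) (a : nat) : vec d -> vec d -> nat :=
  fun v1 v2 => if cube_dom v1 v2 then base_digit n a v1 v2 else 0%N.

Definition T (d : nat) (n : 'I_d -> nat) (c : vec d -> vec d -> nat) : Prop :=
  exists2 a : nat, (a < pbN n)%N & c = cube n a.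

Definition X (d : nat) (n : 'I_d -> nat) (f : vec d -> vec d -> vec d -> nat)
    : Prop :=
  (forall z, T n (f z)) /\
  (forall z i, f z (cst d 0) (cst d (-1) + e i)
               = f (z + e i) (- e i) (cst d (-1))).

(* The label of the undirected edge {z - e_i, z}. *)
Definition label (d : nat) (f : vec d -> vec d -> vec d -> nat)
    (z : vec d) (i : 'I_d) : nat :=
  f z (cst d 0) (- e i).

(* p' - p = a e_j, where the sign a is (-1) ^+ s. *)
Definition is_step (d : nat) (p p' : vec d) (s : bool) (j : 'I_d) : bool :=
  p' - p == (-1) ^+ s *: e j.

Definition adj (d : nat) (p p' : vec d) : bool :=
  [exists s, exists j, is_step p p' s j].

(* (p,p')f.  When p' - p = a e_j, both a and j are determined by p and p', and
   {p, p'} = {z - e_j, z} for z = max{p, p'}. *)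
Definition step_int (d : nat) (n : 'I_d -> nat)
    (f : vec d -> vec d -> vec d -> nat) (p p' : vec d) : rat :=
  if [pick sj : bool * 'I_d | is_step p p' sj.1 sj.2] is Some (s, j)
  then (-1) ^+ s * wgt n (vmax p p') * (label f (vmax p p') j)%:Q
  else 0.

Definition path_int (d : nat) (n : 'I_d -> nat)
    (f : vec d -> vec d -> vec d -> nat) (P : seq (vec d)) : rat :=
  \sum_(i < (size P).-1) step_int n f P`_i P`_i.+1.

(* Main.v *)
(** The labels of [f] form a discrete 1-form with value [wgt z * label z i] on
    the edge {z - e_i, z}.  If [f z = cube a_z], then [label z i = a_z mod n_i],
    and the gluing condition defining [X] says
    [a_(z-e_i) mod (N / n_i) = a_z div n_i].  Since [n_j] divides [N / n_i] for
    [i <> j], going from [z - e_i - e_j] to [z] through [z - e_i] contributes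
    [wgt z * (a_z mod n_i + n_i * ((a_z div n_i) mod n_j))
     = wgt z * (a_z mod (n_i * n_j))], which is symmetric in [i] and [j].  So the
    form is closed, hence exact on [Z^d], and path integrals are differences
    of a potential. *)
Require Import Defs.
From HB Require Import structures.
From mathcomp Require Import all_boot all_order all_algebra.
From mathcomp Require Import classical_sets.
From mathcomp Require Import ring zify.

Set Implicit Arguments.
Unset Strict Implicit.
Unset Printing Implicit Defensive.

Import Order.TTheory GRing.Theory Num.Theory.
Local Open Scope ring_scope.

(** * Exactness of closed discrete 1-forms on [Z^d] *)

(** Two-sided indefinite sum normalised to vanish at 0. As [Negz k] is [-(k+1)], the second branch
    runs over [g 0, ..., g (-k)]. *)
Definition antidiff (V : zmodType) (g : int -> V) (t : int) : V :=
  match t with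
  | Posz k => \sum_(l < k) g l.+1%:Z
  | Negz k => - \sum_(l < k.+1) g (- l%:Z)
  end.

Lemma antidiffB (V : zmodType) (g : int -> V) (t : int) :
  antidiff g t - antidiff g (t - 1) = g t.
Proof.
case: t => [[|k]|k].
- have -> : (0 - 1 : int) = Negz 0 by [].
  by rewrite /= big_ord0 big_ord1 opprK add0r oppr0.
- have -> : (k.+1%:Z - 1 = k%:Z)%R by lia.
  by rewrite /= big_ord_recr addrC addKr.
- have -> : (Negz k - 1 = Negz k.+1)%R by lia.
  by rewrite /= opprK [in X in _ + X]big_ord_recr /= addKr NegzE.
Qed.

Lemma eq_antidiff (V : zmodType) (g h : int -> V) :
  g =1 h -> antidiff g =1 antidiff h.
Proof.
by move=> gh [k|k] /=; [|congr (- _)]; apply: eq_bigr => l _; apply: gh.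
Qed.

Lemma e_diag (d : nat) (i : 'I_d) : e i 0 i = 1.
Proof. by rewrite mxE !eqxx. Qed.

Lemma e_offdiag (d : nat) (i j : 'I_d) : j != i -> e i 0 j = 0.
Proof. by move=> ji; rewrite mxE (negPf ji) andbF. Qed.

(** Discrete Poincaré lemma. The potential is built one direction at a time, by induction on the
    list [r] of directions already treated. *)
Lemma closed_form_exact (d : nat) (V : zmodType) (G : 'I_d -> vec d -> V) :
  (forall i j z, G i z + G j (z - e i) = G j z + G i (z - e j)) ->
  exists Phi : vec d -> V, forall i z, Phi z - Phi (z - e i) = G i z.
Proof.
move=> closedG.
suff /(_ (enum 'I_d))[Phi PhiP] : forall r : seq 'I_d,
    exists Phi : vec d -> V,
      forall i, i \in r -> forall z, Phi z - Phi (z - e i) = G i z.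
  by exists Phi => i z; apply: PhiP; rewrite mem_enum.
elim=> [|k r [Phi PhiP]]; first by exists (fun=> 0).
pose H z := G k z - (Phi z - Phi (z - e k)).
(* Closedness makes the defect [H] of [Phi] in direction [k] invariant under the
   directions already treated, so integrating it along [k] does not spoil them. *)
have H_inv i z : i \in r -> H (z - e i) = H z.
  move=> ir; rewrite /H.
  have := closedG i k z; rewrite -!(PhiP i ir).
  rewrite (addrAC z (- e k)) => closed; apply: (addrI (Phi z - Phi (z - e i))).
  rewrite addrA closed -(addrA (G k z)) [RHS]addrCA; congr (G k z + _).
  by rewrite !opprB addrA subrK [RHS]addrC addrA subrK.
(* The defect at the point with [k]-th coordinate [t] on the line through [z] along [e k]; it does
   not change when [z] moves along that line. *)
pose line (z : vec d) t := H (z + (t - z 0 k) *: e k).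
exists (fun z : vec d => Phi z + antidiff (line z) (z 0 k)) => i.
rewrite inE => ir z; rewrite opprD addrACA.
have [->|ik] := eqVneq i k.
  have line_shift : line (z - e k) =1 line z.
    move=> t; rewrite /line !mxE !eqxx /=; congr H.
    by rewrite opprD opprK addrA scalerDl scale1r addrACA addNr addr0.
  rewrite (eq_antidiff line_shift) !mxE !eqxx antidiffB.
  by rewrite /line subrr scale0r addr0 /H addrC subrK.
have {}ir : i \in r by move: ir; rewrite (negPf ik).
have line_inv : line (z - e i) =1 line z.
  move=> t; rewrite /line !mxE eq_sym (negPf ik) subr0 addrAC.
  exact: H_inv.
rewrite (eq_antidiff line_inv) !mxE [k == i]eq_sym (negPf ik) subr0 subrr addr0.
exact: PhiP.
Qed.

(** * Weights and mixed-radix digits *)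

Lemma m0 (d : nat) (n : 'I_d -> nat) : m n (cst d 0) = 1.
Proof. by rewrite /m big1 // => j _; rewrite mxE oppr0 expr0z. Qed.

Lemma mD (d : nat) (n : 'I_d -> nat) (u v : vec d) :
  prebasis n -> m n (u + v) = m n u * m n v.
Proof.
move=> n_gt0; rewrite /m -big_split; apply: eq_bigr => j _ /=.
by rewrite mxE opprD expfzDr // intr_eq0 eqz_nat -lt0n n_gt0.
Qed.

Lemma mNe (d : nat) (n : 'I_d -> nat) (i : 'I_d) : m n (- e i) = (n i)%:Q.
Proof.
rewrite /m (bigD1 i) //= big1 ?mulr1 => [|j ji].
  by rewrite mxE e_diag opprK expr1z.
by rewrite mxE e_offdiag // oppr0 expr0z.
Qed.

Lemma mN1 (d : nat) (n : 'I_d -> nat) : m n (cst d (-1)) = (pbN n)%:Q.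
Proof.
rewrite /m /pbN -[RHS]pmulrn natr_prod; apply: eq_bigr => j _.
by rewrite mxE opprK expr1z pmulrn.
Qed.

Lemma mN1e (d : nat) (n : 'I_d -> nat) (i : 'I_d) : prebasis n ->
  m n (cst d (-1) + e i) = (\prod_(j | j != i) n j)%N%:Q.
Proof.
move=> n_gt0.
have ni0 : (n i)%:Q != 0 by rewrite intr_eq0 eqz_nat -lt0n n_gt0.
apply: (mulIf ni0); rewrite -mNe -mD // addrK mN1 mNe /pbN (bigD1 i) //=.
by rewrite mulnC PoszM intrM.
Qed.

(** With integral weights [M1] and [M1 * M2], the representation is the mixed-radix expansion of
    [a], obtained by dividing by [M1] and then by [M2]. *)
Lemma base_digitE (d : nat) (n : 'I_d -> nat) (a M1 M2 : nat) (v1 v2 : vec d) :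
  (0 < M1)%N -> (0 < M2)%N -> m n v1 = M1%:Q -> m n v2 = (M1 * M2)%N%:Q ->
  base_digit n a v1 v2 = ((a %/ M1) %% M2)%N.
Proof.
move=> M1_gt0 M2_gt0 mv1 mv2.
have M1_neq0 : M1%:Q != 0 by rewrite intr_eq0 eqz_nat -lt0n.
have mv21 : m n v2 / m n v1 = M2%:Q.
  by rewrite mv1 mv2 PoszM intrM mulrC mulKf.
have reprE a0 a1 a2 : base_repr n a v1 v2 a0 a1 a2 <->
    [/\ a = (a0 + a1 * M1 + a2 * (M1 * M2))%N, (a0 < M1)%N & (a1 < M2)%N].
  rewrite /base_repr mv21 mv1 mv2 -!intrM -!intrD !ltr_int !ltz_nat.
  split=> -[aE ? ?]; split=> //; last by rewrite aE.
  by move/intr_inj: aE; lia.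
have repr_digit a0 a1 a2 : base_repr n a v1 v2 a0 a1 a2 ->
    a1 = ((a %/ M1) %% M2)%N.
  move=> /reprE[-> a0M1 a1M2].
  have -> : (a0 + a1 * M1 + a2 * (M1 * M2) = (a2 * M2 + a1) * M1 + a0)%N by ring.
  by rewrite divnMDl // divn_small // addn0 modnMDl modn_small.
rewrite /base_digit; case: xgetP => [a1 _ [a0 [a2]] /repr_digit //|].
(* The default value of [xget] never occurs: the two successive divisions provide a
   representation. *)
move/(_ ((a %/ M1) %% M2)%N); case.
exists (a %% M1)%N, (a %/ M1 %/ M2)%N; apply/reprE; split; rewrite ?ltn_mod //.
rewrite {1}(divn_eq a M1) {1}(divn_eq (a %/ M1) M2); ring.
Qed.

(** Both sides are [a %% (k * l)]. Zero moduli fit in because [a %% 0 = a]. *)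
Lemma modn_divn_swap (a k l : nat) :
  (a %% k + k * ((a %/ k) %% l) = a %% l + l * ((a %/ l) %% k))%N.
Proof.
suff E b c : (a %% b + b * ((a %/ b) %% c) = a %% (b * c))%N.
  by rewrite !E mulnC.
have [->|b_gt0] := posnP b; first by rewrite !mul0n addn0.
have [->|c_gt0] := posnP c; first by rewrite muln0 !modn0 addnC mulnC -divn_eq.
have aE : a = (a %/ b %/ c * (b * c) + (a %% b + b * ((a %/ b) %% c)))%N.
  by rewrite {1}(divn_eq a b) {1}(divn_eq (a %/ b) c); ring.
rewrite [in RHS]aE modnMDl [RHS]modn_small //.
apply: (@leq_trans (b * ((a %/ b) %% c).+1)%N).
  by rewrite mulnS ltn_add2r ltn_mod.
by rewrite leq_mul2l ltn_mod c_gt0 orbT.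
Qed.

(** * Edges and faces of multiplication cubes *)

Lemma in_cube0 (d : nat) : in_cube (cst d 0).
Proof. by apply/forallP => j; rewrite mxE eqxx orbT. Qed.

Lemma in_cubeN1 (d : nat) : in_cube (cst d (-1)).
Proof. by apply/forallP => j; rewrite mxE eqxx. Qed.

Lemma in_cubeNe (d : nat) (i : 'I_d) : in_cube (- e i).
Proof. by apply/forallP => j; rewrite !mxE; case: (j == i). Qed.

Lemma in_cubeN1e (d : nat) (i : 'I_d) : in_cube (cst d (-1) + e i).
Proof. by apply/forallP => j; rewrite !mxE; case: (j == i). Qed.

Lemma lev_cube0 (d : nat) (v : vec d) : in_cube v -> lev v (cst d 0).
Proof.
move=> /forallP v_cube; apply/forallP => j; rewrite [leRHS]mxE.
by case/orP: (v_cube j) => /eqP->.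
Qed.

Lemma lev_cubeN1 (d : nat) (v : vec d) : in_cube v -> lev (cst d (-1)) v.
Proof.
move=> /forallP v_cube; apply/forallP => j; rewrite [leLHS]mxE.
by case/orP: (v_cube j) => /eqP->.
Qed.

Section Cubes.
Variables (d : nat) (n : 'I_d -> nat).
Hypothesis n_gt0 : prebasis n.

Lemma cofactor_gt0 (i : 'I_d) : (0 < \prod_(j | j != i) n j)%N.
Proof. by apply: prodn_gt0 => j; apply: n_gt0. Qed.

Lemma cube_edge (a : nat) (i : 'I_d) :
  cube n a (cst d 0) (- e i) = (a %% n i)%N.
Proof.
rewrite /cube /cube_dom in_cube0 in_cubeNe lev_cube0 ?in_cubeNe //=.
by rewrite (@base_digitE _ _ _ 1 (n i)) ?divn1 ?m0 ?mNe ?mul1n.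
Qed.

Lemma cube_lower_face (a : nat) (i : 'I_d) :
  cube n a (cst d 0) (cst d (-1) + e i) = (a %% \prod_(j | j != i) n j)%N.
Proof.
rewrite /cube /cube_dom in_cube0 in_cubeN1e lev_cube0 ?in_cubeN1e //=.
by rewrite (@base_digitE _ _ _ 1 (\prod_(j | j != i) n j))
  ?divn1 ?m0 ?mN1e ?mul1n ?cofactor_gt0.
Qed.

Lemma cube_upper_face (a : nat) (i : 'I_d) : (a < pbN n)%N ->
  cube n a (- e i) (cst d (-1)) = (a %/ n i)%N.
Proof.
move=> aN; have pbNE : pbN n = (n i * \prod_(j | j != i) n j)%N.
  by rewrite /pbN (bigD1 i).
rewrite /cube /cube_dom in_cubeNe in_cubeN1 lev_cubeN1 ?in_cubeNe //=.
rewrite (@base_digitE _ _ _ (n i) (\prod_(j | j != i) n j))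
  ?mNe ?mN1 ?pbNE ?cofactor_gt0 //.
(* From [a < pbN n], the quotient [a %/ n i] is already below the cofactor, so the outer reduction
   is trivial. *)
by rewrite modn_small // ltn_divLR // mulnC -pbNE.
Qed.

Lemma label_form_closed (f : vec d -> vec d -> vec d -> nat) :
  X n f -> forall i j z,
  wgt n z * (label f z i)%:Q + wgt n (z - e i) * (label f (z - e i) j)%:Q =
  wgt n z * (label f z j)%:Q + wgt n (z - e j) * (label f (z - e j) i)%:Q.
Proof.
move=> [fT fglue] i j z; have [->//|ij] := eqVneq i j.
have [a aN fz] := fT z.
have labelE k l : l != k -> label f (z - e k) l = ((a %/ n k) %% n l)%N.
  move=> lk; have [b _ fb] := fT (z - e k).
  have := fglue (z - e k) k; rewrite subrK fz fb.
  rewrite cube_lower_face cube_upper_face // => <-.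
  (* Since [l != k], [n l] divides the cofactor of [k], so reducing [b] modulo that cofactor first
     keeps [b %% n l]. *)
  by rewrite /label fb cube_edge modn_dvdm // (bigD1 l) //= dvdn_mulr.
rewrite !labelE // 1?eq_sym // /label fz !cube_edge /wgt !mD // !mNe.
by rewrite -!mulrA -!mulrDr -!intrM -!intrD -!PoszM -!PoszD modn_divn_swap.
Qed.

End Cubes.

(** * Path integrals as differences of a potential *)

Lemma path_int_potential (d : nat) (n : 'I_d -> nat)
    (f : vec d -> vec d -> vec d -> nat) (Phi : vec d -> rat) :
  (forall i z, Phi z - Phi (z - e i) = wgt n z * (label f z i)%:Q) ->
  forall x s, path (@adj d) x s ->
  path_int n f (x :: s) = Phi (last x s) - Phi x.
Proof.
move=> PhiP.
have vmaxDe (z : vec d) i : vmax z (z + e i) = z + e i.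
  apply/rowP => j; rewrite [LHS]mxE; apply/max_idPr.
  by rewrite [leRHS]mxE lerDl mxE; case: (_ && _).
have vmaxC (u v : vec d) : vmax u v = vmax v u.
  by apply/rowP => j; rewrite !mxE maxC.
have stepE p p' : adj p p' -> step_int n f p p' = Phi p' - Phi p.
  rewrite /step_int => /existsP[s0 /existsP[j0 step0]].
  (* The picked pair need not be identified with [(s0, j0)]: any pair satisfying [is_step] gives the
     same difference. For a backward step the maximum is [p], for a forward step [p']. *)
  case: pickP => [[[] j]|/(_ (s0, j0))] /=; last by rewrite step0.
    rewrite /is_step expr1 scaleN1r subr_eq => /eqP; rewrite addrC => p'E.
    have {1 2}-> : p = p' + e j by rewrite p'E subrK.
    rewrite vmaxC vmaxDe -mulrA -PhiP addrK mulN1r opprB.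
    by rewrite p'E subrK.
  rewrite /is_step expr0 scale1r subr_eq => /eqP; rewrite addrC => ->.
  by rewrite vmaxDe mul1r -PhiP addrK.
move=> x s; elim: s x => [|y s IHs] x /=.
  by rewrite /path_int big_ord0 subrr.
move=> /andP[/stepE xy /IHs ys].
rewrite /path_int big_ord_recl /= xy -[X in _ + X]/(path_int n f (y :: s)) ys.
by rewrite addrC addrA subrK.
Qed.

Theorem theorem4p11 (d : nat) (n : 'I_d -> nat) (hn : prebasis n)
    (f : vec d -> vec d -> vec d -> nat) (hf : X n f) :
  (forall (x x' : vec d) (s s' : seq (vec d)),
      path (@adj d) x s -> path (@adj d) x' s' ->
      x = x' -> last x s = last x' s' ->
      path_int n f (x :: s) = path_int n f (x' :: s')) /\
  (forall (x : vec d) (s : seq (vec d)),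
      path (@adj d) x s -> last x s = x -> path_int n f (x :: s) = 0).
Proof.
have [Phi PhiP] := closed_form_exact (label_form_closed hn hf).
have path_intE := path_int_potential PhiP.
split=> [x x' s s' xs xs' xx' ss'|x s xs sx].
  by rewrite !path_intE // ss' xx'.
by rewrite path_intE // sx subrr.
Qed.
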